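(* Let $q$ be an odd prime power and $k$ an integer such that $q\ge 5$ and $2\le k\le q-3$. If $u(x)=\lambda x^k+\gamma x^{k-1}+f_{\le k-2}(x)$ with $\lambda\in\mathbf{F}_q^*$, $\gamma\in\mathbf{F}_q$ and $f_{\le k-2}(x)\in\mathbf{F}_q[x]$ a polynomial of degree at most $k-2$, then the received word $(u(\mathbf{F}_q^* ),\gamma)\in\mathbf{F}_q^{q}$ is not a deep hole of the primitive projective Reed-Solomon code ${\rm PPRS}_q(\mathbf{F}_q^*,k)$.
   Context: $\mathbf{F}_q$ is the finite field with $q$ elements; $\mathbf{F}_q^*$ is its set of nonzero elements. Polynomials ''of degree at most $m$'' include the zero polynomial. Let $\alpha$ be a primitive element of $\mathbf{F}_q$ (a generator of $\mathbf{F}_q^*$). For $f(x)\in\mathbf{F}_q[x]$, put $f(\mathbf{F}_q^* ):=(f(1),f(\alpha),\ldots,f(\alpha^{q-2}))$ and let $c_{k-1}(f(x))$ be the coefficient of $x^{k-1}$ in $f(x)$. The primitive projective Reed-Solomon code is ${\rm PPRS}_q(\mathbf{F}_q^*,k):=\{(f(\mathbf{F}_q^* ),c_{k-1}(f(x)))\in\mathbf{F}_q^{q} : f(x)\in\mathbf{F}_q[x],\ \deg f(x)\le k-1\}$. For a code $C\subseteq \mathbf{F}_q^{N}$, $d(\cdot,\cdot)$ denotes Hamming distance (the number of coordinates in which two words differ), $d(w,C):=\min_{v\in C} d(w,v)$ is the error distance of $w\in\mathbf{F}_q^N$, and $\rho(C):=\max\{d(w,C): w\in\mathbf{F}_q^N\}$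 is the covering radius. A word $w\in\mathbf{F}_q^{N}\setminus C$ is a deep hole of $C$ if $d(w,C)=\rho(C)$. *)

(* Defs.v *)
From mathcomp Require Import all_boot all_order all_fingroup all_algebra.
From mathcomp Require Import all_solvable all_field.

Set Implicit Arguments.
Unset Strict Implicit.
Unset Printing Implicit Defensive.

Import GRing.Theory.
Local Open Scope ring_scope.

Section Codes.
Context {F : finFieldType} {N : nat}.
Implicit Types (v w : 'rV[F]_N) (C : {set 'rV[F]_N}).

Definition hamming_dist v w : nat := #|[set i : 'I_N | v 0 i != w 0 i]|.

(* The neutral element N bounds every Hamming distance, so this is the minimum
   over C when C is nonempty; for C empty the value is N. *)
Definition error_dist w C : nat :=
  \big[minn/N]_(v in C) hamming_dist w v.

Definition covering_radius C : nat := (\max_w error_dist w C)%N.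

Definition deep_hole C w : bool :=
  (w \notin C) && (error_dist w C == covering_radius C).

End Codes.

(* (f(1), f(alpha), ..., f(alpha^(q-2)), c), where q = #|F|. *)
Definition proj_word (F : finFieldType) (alpha : F) (f : {poly F}) (c : F) :
    'rV[F]_#|F| :=
  \row_(i < #|F|) if (i < #|F|.-1)%N then f.[alpha ^+ i] else c.

(* {poly_k F} is the finite type of polynomials of size at most k, that is,
   of degree at most k - 1, including 0. *)
Definition PPRS (F : finFieldType) (alpha : F) (k : nat) :
    {set 'rV[F]_#|F|} :=
  [set proj_word alpha p (p : {poly F})`_k.-1 | p : {poly_k F}].

(* Main.v *)
Require Import Defs.
From mathcomp Require Import all_boot all_order all_fingroup all_algebra.
From mathcomp Require Import all_solvable all_field.
From mathcomp Require Import zify ring.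

(** Write q for the cardinality of F and C for the code.  Comparing a word
    with the codeword of a polynomial g of degree at most k - 1 amounts to
    counting the roots of one polynomial among the nonzero elements, with one
    more agreement if the last entries coincide
    ([hamming_dist_ext_word]).  The received word fails to be a deep hole
    because it is strictly closer to C than another explicit word.

    The far word is (1/x on the nonzero elements, 0).  It agrees with the
    codeword of g at the roots of X g - 1, a nonzero polynomial of degree at
    most k, and of degree at most k - 1 when the last entries agree as well.
    Hence there are at most k agreements in all, and the distance to C is at
    least q - k ([error_dist_inverse_word]).

    The received word u is close to C because k distinct nonzero elements of F
    with sum 0 exist ([zero_sum_subset]).  Let P be the monic polynomial of
    degree k with these roots; its coefficient of degree k - 1 is minus their
    sum, that is, 0.  Subtracting u_k P from u therefore cancels the term of
    degree k, leaves the last entry alone, and changes no value at the k roots.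
    This gives a codeword with k + 1 agreements, and the distance from u to C
    is at most q - k - 1 ([error_dist_le_zero_sum]).

    In odd characteristic the zero-sum set is a union of pairs {x, -x}, together
    with one zero-sum triple if k is odd. *)

Set Implicit Arguments.
Unset Strict Implicit.
Unset Printing Implicit Defensive.

Import GRing.Theory.
Local Open Scope ring_scope.

(** * Comparing error distances *)

Section ErrorDistance.
Context {F : finFieldType} {N : nat}.
Implicit Types (v w : 'rV[F]_N) (C : {set 'rV[F]_N}).

Lemma error_dist_le C w v : v \in C -> (error_dist w C <= hamming_dist w v)%N.
Proof.
move=> Cv.
exact: (@Order.TotalTheory.bigmin_le_cond _ nat _ N v (mem C) _ Cv).
Qed.

Lemma le_error_dist C w m :
  (m <= N)%N -> (forall v, v \in C -> (m <= hamming_dist w v)%N) ->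
  (m <= error_dist w C)%N.
Proof.
move=> mN mC; rewrite /error_dist; elim/big_ind: _ => // x y mx my.
by rewrite leq_min mx my.
Qed.

Lemma not_deep_hole C w w' :
  (error_dist w C < error_dist w' C)%N -> ~~ deep_hole C w.
Proof.
move=> lt_w_w'; rewrite negb_and neq_ltn.
have /(leq_trans lt_w_w') -> : (error_dist w' C <= covering_radius C)%N.
  exact: leq_bigmax.
by rewrite orbT.
Qed.

End ErrorDistance.

(** * Zero-sum sets of nonzero elements *)

Section FiniteField.
Context {F : finFieldType}.
Implicit Types (T S : {set F}) (k m : nat).

(** The additive order of 1 divides #|F|, so #|F| vanishes in F.  If 2 vanished
    as well, the odd number #|F| would be both 0 and 1 in F. *)
Lemma two_neq0_of_odd_card : odd #|F| -> (2 : F) != 0.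
Proof.
move=> oddF; apply/eqP => F2.
have : (#|F|%:R : F) = 0.
  by have := expg_cardG (in_setT (1 : F)); rewrite cardsT FinRing.zmodXgE.
rewrite -(odd_double_half #|F|) oddF natrD -muln2 natrM F2 mulr0 addr0.
by move/eqP; rewrite oner_eq0.
Qed.

(** A pair {x, -x} has two elements and sum 0, and the complement in T of a
    union of such pairs is again stable under negation: pairs can be collected
    one at a time until the prescribed size is reached. *)
Lemma symmetric_subset T m :
  (2 : F) != 0 -> 0 \notin T -> {in T, forall x, - x \in T} ->
  (m.*2 <= #|T|)%N ->
  exists2 S : {set F}, S \subset T & #|S| = m.*2 /\ \sum_(x in S) x = 0.
Proof.
move=> F2 T0 symT mT.
(* The induction must also remember that S is symmetric. *)
suff [S [sST cardS sumS _]] : exists S : {set F},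
    [/\ S \subset T, #|S| = m.*2, \sum_(x in S) x = 0
      & {in S, forall x, - x \in S}] by exists S.
elim: m mT => [|m IHm] mT.
  by exists set0; rewrite sub0set cards0 big_set0; split=> // x; rewrite inE.
have [|S [sST cardS sumS symS]] := IHm; first lia.
have [x xT xS] : exists2 x, x \in T & x \notin S.
  by apply/subsetPn; apply: contraTN mT => /subset_leq_card; lia.
have NxS : - x \notin S by apply: contra xS => /symS; rewrite opprK.
have x_neqN : x != - x.
  rewrite -subr_eq0 opprK -mulr2n -mulr_natl mulf_neq0 //.
  by apply: contraNneq T0 => <-.
have xNS : x \notin - x |: S by rewrite !inE negb_or x_neqN.
exists (x |: (- x |: S)); split.
- by rewrite !subUset !sub1set xT symT.
- by rewrite !cardsU1 NxS xNS cardS doubleS.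
- by rewrite !big_setU1 //= sumS addr0 subrr.
move=> y; rewrite !inE.
by case/or3P=> [/eqP->|/eqP->|/symS->]; rewrite ?opprK ?eqxx ?orbT.
Qed.

(** The triple is {1, b, -(1 + b)}.  It is degenerate only for the five values
    of b below, and the field has at least seven elements. *)
Lemma zero_sum_triple :
  (2 : F) != 0 -> (7 <= #|F|)%N ->
  exists S : {set F}, [/\ 0 \notin S, #|S| = 3%N & \sum_(x in S) x = 0].
Proof.
move=> F2 F7.
(* 0 and 1 exclude b = 0 and b = 1; -1, -2 and -1/2 exclude that the third
   element is 0, 1 and b, respectively. *)
pose bad : {set F} := [set x in [:: 0; 1; -1; -2; - 2^-1]].
have /card_gt0P[b] : (0 < #|~: bad|)%N.
  have : (#|bad| <= 5)%N by rewrite cardsE; apply: card_size.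
  by move: F7; rewrite -(cardsC bad); lia.
rewrite !inE !negb_or => /and5P[b0 b1 bN1 bN2 bNh].
have c0 : - (1 + b) != 0 by rewrite oppr_eq0 addrC addr_eq0.
have c1 : 1 != - (1 + b).
  by rewrite -subr_eq0 (_ : _ - _ = b - - 2) ?subr_eq0 //; ring.
have cb : b != - (1 + b).
  by rewrite -subr_eq0 (_ : _ - _ = 2 * (b - - 2^-1)) ?mulf_neq0 ?subr_eq0 //; field.
exists (1 |: [set b; - (1 + b)]); split.
- by rewrite !inE ![0 == _]eq_sym !negb_or oner_neq0 b0 c0.
- by rewrite cardsU1 cards2 cb !inE (eq_sym 1 b) (negPf b1) (negPf c1).
- rewrite big_setU1 ?inE /= 1?(eq_sym 1 b) ?(negPf b1) ?(negPf c1) //.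
  by rewrite big_setU1 ?inE //= big_set1; ring.
Qed.

(** For even k, take k / 2 pairs {x, -x}.  For odd k, take a zero-sum triple B
    and (k - 3) / 2 pairs avoiding B and -B; there is room for them since k
    cannot equal #|F| - 3, which is even. *)
Lemma zero_sum_subset k :
  odd #|F| -> (2 <= k)%N -> (k <= #|F| - 3)%N ->
  exists S : {set F}, [/\ 0 \notin S, #|S| = k & \sum_(x in S) x = 0].
Proof.
move=> oddF k2 kF; have F2 := two_neq0_of_odd_card oddF.
have kE := odd_double_half k; case oddk: (odd k) kE => kE.
  have kF4 : (k + 4 <= #|F|)%N by lia.
  have [|B [B0 cardB sumB]] := zero_sum_triple F2; first lia.
  pose D := [set x | (x \in B) || (- x \in B)].
  have cardD : (#|D| <= 6)%N.
    have -> : D = B :|: [set - x | x in B].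
      apply/setP=> x; rewrite !inE; congr (_ || _).
      by apply/idP/imsetP => [?|[y yB ->]]; [exists (- x); rewrite ?opprK | rewrite opprK].
    rewrite cardsU card_imset ?cardB; last exact: oppr_inj.
    exact: leq_subr.
  have [||| S sST [cardS sumS]] := @symmetric_subset (~: ((0 : F) |: D)) (k./2).-1 F2.
  - by rewrite !inE eqxx.
  - by move=> x; rewrite !inE oppr_eq0 opprK [(_ \in B) || _]orbC.
  - by move: kF4; rewrite -(cardsC ((0 : F) |: D)) cardsU1; case: (_ \notin D); lia.
  have S_ x : x \in S -> x != 0 /\ x \notin B.
    by move/(subsetP sST); rewrite !inE !negb_or => /and3P[].
  have disj : [disjoint S & B].
    by rewrite disjoint_subset; apply/subsetP=> x /S_[].
  exists (S :|: B); split.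
  - by rewrite inE negb_or B0 andbT; apply/negP=> /S_[]; rewrite eqxx.
  - by have := cardsUI S B; rewrite (disjoint_setI0 disj) cards0; lia.
  - rewrite (eq_bigl [predU S & B]) => [|x]; last by rewrite !inE.
    by rewrite bigU //= sumS sumB addr0.
have [||| S sST [cardS sumS]] := @symmetric_subset [set~ 0] k./2 F2.
- by rewrite !inE eqxx.
- by move=> x; rewrite !inE oppr_eq0.
- by have -> : (#|[set~ 0%R : F]| = #|F|.-1)%N; [exact: cardsC1 | lia].
exists S; split=> //; last lia.
by apply/negP => /(subsetP sST); rewrite !inE eqxx.
Qed.

End FiniteField.

(** * Distances to the code *)

Section PPRSCode.
Context {F : finFieldType} (alpha : {unit F}).
Hypothesis alphaP : generator [set: {unit F}] alpha.
Implicit Types (g u : {poly F}) (k : nat).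

(** The analogue of [proj_word] for an arbitrary function: [proj_word] is
    convertible to the case where h is the evaluation of a polynomial, while
    inversion is used directly, without writing it as a polynomial. *)
Definition ext_word (h : F -> F) (c : F) : 'rV[F]_#|F| :=
  \row_(i < #|F|) if (i < #|F|.-1)%N then h (val alpha ^+ i) else c.

Lemma sum_powers_generator (G : F -> nat) :
  (\sum_(i < #|F|.-1) G (val alpha ^+ i) = \sum_(x | x != 0%R) G x)%N.
Proof.
have orda : #[alpha]%g = #|F|.-1.
  by rewrite -card_finField_unit orderE -(eqP alphaP).
have inj : {in 'I_#|F|.-1 &, injective (fun i : 'I_#|F|.-1 => val alpha ^+ i)}.
  move=> i j _ _; rewrite -!FinRing.val_unitX => /val_inj/eqP.
  by rewrite eq_expg_mod_order orda !modn_small // => /eqP/val_inj.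
have imE : [set val alpha ^+ (i : 'I_#|F|.-1) | i in 'I_#|F|.-1] = [set~ 0].
  apply/eqP; rewrite eqEcard card_in_imset // cardsC1 card_ord leqnn andbT.
  apply/subsetP=> _ /imsetP[i _ ->]; rewrite !inE -FinRing.val_unitX.
  by rewrite -unitfE (valP (alpha ^+ i)%g).
rewrite -(big_imset G inj) imE; apply: eq_bigl => x; exact: in_setC1.
Qed.

(** Counting over positions i becomes counting over the field elements alpha^i,
    so that alpha disappears from the rest of the argument. *)
Lemma hamming_dist_ext_word (h h' : F -> F) (c c' : F) :
  hamming_dist (ext_word h c) (ext_word h' c') =
  (#|[set x : F | (x != 0%R) && (h x != h' x)]| + (c != c'))%N.
Proof.
have F0 : (0 < #|F|)%N by apply/card_gt0P; exists 0.
pose G (i : nat) : nat :=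
  if (i < #|F|.-1)%N then h (val alpha ^+ i) != h' (val alpha ^+ i) else c != c'.
have -> : hamming_dist (ext_word h c) (ext_word h' c') = (\sum_(i < #|F|) G i)%N.
  rewrite /hamming_dist -sum1dep_card big_mkcond; apply: eq_bigr => i _.
  by rewrite !mxE /G; case: (i < _)%N; case: (_ != _).
rewrite -(prednK F0) big_ord_recr /= {2}/G ltnn; congr (_ + _)%N.
rewrite (eq_bigr (fun i : 'I_#|F|.-1 =>
  (h (val alpha ^+ i) != h' (val alpha ^+ i) : nat))); last first.
  by move=> i _; rewrite /G ltn_ord.
rewrite (sum_powers_generator (fun x => h x != h' x : nat)).
by rewrite -sum1dep_card big_mkcondr; apply: eq_bigr => x _; case: eqP.
Qed.

Lemma mem_PPRS k g :
  (size g <= k)%N -> ext_word (horner g) g`_k.-1 \in PPRS (val alpha) k.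
Proof.
by move=> gk; apply/imsetP; exists (npolyp k g); rewrite // npolypK.
Qed.

(** The equation 1/x = g(x) says that x is a root of X g - 1, which is nonzero
    because of its constant term.  Its degree is at most k, and drops below k
    exactly when the coefficient of g that is the last entry of the codeword
    agrees with the entry 0 of the word. *)
Lemma error_dist_inverse_word k :
  (0 < k)%N ->
  (#|F| - k <= error_dist (ext_word (@GRing.inv F) 0%R) (PPRS (val alpha) k))%N.
Proof.
move=> k0; apply: le_error_dist => [|_ /imsetP[g _ ->]]; first lia.
rewrite [proj_word _ _ _](_ : _ = ext_word (horner g) (g : {poly F})`_k.-1) //.
rewrite hamming_dist_ext_word.
set D := [set x | _]; set A := [set x : F | (x != 0) && (x^-1 == g.[x])].
have cardDA : (#|D| + #|A| = #|F|.-1)%N.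
  rewrite -(cardsC1 (0 : F)) -cardsUI.
  have -> : D :&: A = set0.
    by apply/setP=> x; rewrite !inE; case: (x^-1 == _); rewrite ?andbF.
  rewrite cards0 addn0; congr #|pred_of_set _|; apply/setP=> x.
  by rewrite !inE -andb_orr orNb andbT.
suff : (#|A| <= k.-1 + ((g`_k.-1)%R != 0%R))%N.
  have count n d a c :
    (d + a = n.-1 -> a <= k.-1 + c -> n - k <= d + c)%N by lia.
  by rewrite [0 == _]eq_sym; apply: count cardDA.
pose P := 'X * (g : {poly F}) - 1.
have P_neq0 : P != 0.
  apply/eqP => /(congr1 (horner^~ 0)); rewrite !hornerE => /eqP.
  by rewrite oppr_eq0 oner_eq0.
have Aroot : all (root P) (enum A).
  apply/allP=> x; rewrite mem_enum inE => /andP[x0 /eqP xg].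
  by rewrite /root !hornerE -xg divff // subrr.
rewrite cardE -ltnS.
apply: leq_trans (max_poly_roots P_neq0 Aroot (enum_uniq _)) _.
apply/leq_sizeP => j; rewrite /P coefB coefXM coef1.
case: j => // j lej; rewrite /= subr0.
have := size_npoly g; move/leq_sizeP => gk.
case: (altP (g`_k.-1 =P 0)) lej => [gk1|_] lej; last by apply: gk; lia.
have [<-//|kj] := eqVneq k.-1 j; apply: gk; lia.
Qed.

(** With P the monic polynomial whose roots are the elements of S, the codeword
    of u - u_k P agrees with the word of u on S and in the last position. *)
Lemma error_dist_le_zero_sum k (u : {poly F}) (S : {set F}) :
  (0 < k)%N -> (size u <= k.+1)%N ->
  0 \notin S -> #|S| = k -> \sum_(x in S) x = 0 ->
  (error_dist (ext_word (horner u) (u`_k.-1)%R) (PPRS (val alpha) k) < #|F| - k)%N.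
Proof.
move=> k0 uk S0 cardS sumS.
pose P := \prod_(s <- enum S) ('X - s%:P).
have sizeS : size (enum S) = k by rewrite -cardE.
have sizeP : size P = k.+1 by rewrite size_prod_XsubC sizeS.
have Pk : P`_k = 1.
  by have /monicP := monic_prod_XsubC (enum S) xpredT id; rewrite lead_coefE sizeP.
have Pk1 : P`_k.-1 = 0.
  rewrite -sizeS coefPn_prod_XsubC ?sizeS -?lt0n // big_enum sumS.
  exact: oppr0.
pose g := u - u`_k *: P.
have gk : (size g <= k)%N.
  apply/leq_sizeP => j; rewrite leq_eqVlt coefB coefZ => /orP[/eqP<-|kj].
    by rewrite Pk mulr1 subrr.
  by rewrite [P`_j]nth_default ?sizeP // mulr0 subr0 nth_default ?(leq_trans uk).
have gk1 : g`_k.-1 = u`_k.-1 by rewrite coefB coefZ Pk1 mulr0 subr0.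
apply: leq_ltn_trans (error_dist_le _ (mem_PPRS gk)) _.
rewrite hamming_dist_ext_word gk1 eqxx addn0.
apply: (@leq_ltn_trans #|~: ((0 : F) |: S)|).
  apply/subset_leq_card/subsetP => x; rewrite !inE negb_or => /andP[-> /=].
  apply: contra => xS; have : root P x by rewrite root_prod_XsubC mem_enum.
  by rewrite /g !hornerE => /rootP ->; rewrite mulr0 subr0.
have count n c : (1 + k + c = n -> c < n - k)%N by lia.
by apply: count; rewrite -[RHS](cardsC ((0 : F) |: S)) cardsU1 S0 cardS.
Qed.

End PPRSCode.

Theorem theorem1p6 (F : finFieldType) (alpha : {unit F}) (k : nat)
    (lambda gamma : F) (f u : {poly F})
    (halpha : generator [set: {unit F}] alpha)
    (hodd : odd #|F|) (hq : (5 <= #|F|)%N)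
    (hk2 : (2 <= k)%N) (hkq : (k <= #|F| - 3)%N)
    (hlambda : lambda != 0)
    (hf : (size f <= k.-1)%N)
    (hu : u = lambda *: 'X^k + gamma *: 'X^(k.-1) + f) :
  ~~ deep_hole (PPRS (val alpha) k) (proj_word (val alpha) u gamma).
Proof.
have [S [S0 cardS sumS]] := zero_sum_subset hodd hk2 hkq.
have k0 : (0 < k)%N by lia.
have coefu j : u`_j = lambda * (j == k)%:R + gamma * (j == k.-1)%:R + f`_j.
  by rewrite hu !coefD !coefZ !coefXn.
have f0 j : (k.-1 <= j)%N -> f`_j = 0 by move/(leq_trans hf)/(nth_default 0).
have uk1 : u`_k.-1 = gamma.
  by rewrite coefu eqxx f0 // (_ : k.-1 == k = false) ?mulr1 ?mulr0 ?add0r ?addr0 //; lia.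
have su : (size u <= k.+1)%N.
  apply/leq_sizeP => j kj; rewrite coefu f0; last lia.
  have [-> ->] : (j == k) = false /\ (j == k.-1) = false by lia.
  by rewrite !mulr0 !addr0.
apply: (@not_deep_hole _ _ _ _ (ext_word alpha (@GRing.inv F) 0%R)).
apply: leq_trans (error_dist_inverse_word halpha k0).
by rewrite -uk1; apply: (error_dist_le_zero_sum halpha k0 su S0).
Qed.
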